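(* Let $(T_n)_{n\ge 1}$ be a uniform random recursive tree and let $R_n$ be the Jordan rank of the root (vertex $1$) in $T_n$. There exists a constant $c>0$ such that for all $n\ge 1$ and for all $x\in[n]=\{1,\ldots,n\}$, $$\mathbb{P}(R_n>x)\le \frac{c}{x}.$$
   Context: A uniform random recursive tree (URRT) is a random sequence of trees $(T_n)_{n\ge 1}$ with $V(T_n)=[n]=\{1,\ldots,n\}$: $T_1$ is the single vertex $1$ (the root), and $T_{n+1}$ is obtained from $T_n$ by adding vertex $n+1$ and an edge $\{i,n+1\}$, where $i$ is chosen uniformly at random from $[n]$, independently of the past. For a tree $T$ and vertices $u,v$ of $T$, $(T,v)_{u\downarrow}$ denotes the subtree containing all vertices $w$ such that the path from $w$ to $v$ contains $u$ (rooted at $u$), and $|\cdot|$ denotes its number of vertices. The Jordan centrality of $v\in V(T_n)$ is $\psi_{T_n}(v)=\max_{u\in V(T_n)\setminus\{v\}}|(T_n,v)_{u\downarrow}|$; smaller values correspond to more central vertices. Ranking: vertices are ordered from most to least central; vertices with equal centrality value are ordered in reverse order of insertion time (if $u,v$ have equal centrality, $u$ is ranked before $v$ iff $u>v$). This gives a permutation $\gamma_n$ of $[n]$, where $\gamma_n(v)\in\{1,\ldots,n\}$ is the position of $v$ in this order (position $1$ being most central). The rank of the root is $R_n=\gamma_n(1)$. *)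

(* Defs.v *)
(* MathComp-Analysis *)
From mathcomp Require Import all_boot all_order all_algebra.
From mathcomp Require Import all_classical all_reals all_analysis.

Set Implicit Arguments.
Unset Strict Implicit.
Unset Printing Implicit Defensive.

Import Order.TTheory GRing.Theory Num.Theory.

Local Open Scope classical_set_scope.
Local Open Scope nat_scope.

(* A tree with vertex set [n] = {1, ..., n} is given by n together with its
   adjacency relation, a [rel nat] that only relates elements of {1, ..., n}. *)
Definition vertices (n : nat) : seq nat := iota 1 n.

Definition edgeless : rel nat := fun _ _ => false.

Definition add_edge (e : rel nat) (i j : nat) : rel nat :=
  fun u v => [|| e u v, (u == i) && (v == j) | (u == j) && (v == i)].

(* In a tree the simple path from w to v is unique. *)
Definition on_path (e : rel nat) (w v u : nat) : bool :=
  `[< exists p : seq nat,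
        [/\ path e w p, uniq (w :: p), last w p = v & u \in w :: p] >].

(* The vertices of (T, v)_{u \downarrow}. *)
Definition subtree (n : nat) (e : rel nat) (v u : nat) : seq nat :=
  [seq w <- vertices n | on_path e w v u].

(* For n = 1 the maximum is empty and equals 0. *)
Definition jordan (n : nat) (e : rel nat) (v : nat) : nat :=
  \max_(u <- vertices n | u != v) size (subtree n e v u).

(* Ties are broken in favour of the later vertex; this is the reflexive version
   of the ranking, a total order. *)
Definition ranked_before (n : nat) (e : rel nat) : rel nat := fun u v =>
  (jordan n e u < jordan n e v) ||
  ((jordan n e u == jordan n e v) && (v <= u)).

Definition jordan_rank (n : nat) (e : rel nat) (v : nat) : nat :=
  (index v (sort (ranked_before n e) (vertices n))).+1.

(* U n is the vertex of T_n to which the vertex n+1 is attached; only the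
   indices n >= 1 matter.  Since T_1 is deterministic and T_2, ..., T_n and
   U 1, ..., U (n-1) determine each other, the past at time n is given by
   U 1, ..., U (n-1).  These variables are discrete, so every A and B below
   gives an event. *)
Definition urrt {d : measure_display} {Omega : measurableType d} {R : realType}
    (P : probability Omega R) (T : nat -> Omega -> rel nat) : Prop :=
  exists U : nat -> {mfun Omega >-> nat},
    [/\ forall n w, 1 <= n -> U n w \in vertices n,
        forall n i, 1 <= n -> i \in vertices n ->
          P [set w | U n w = i] = ((n%:R : R)^-1)%:E,
        forall n (A : set nat) (B : set (seq nat)), 1 <= n ->
          let present := [set w | A (U n w)] in
          let past := [set w | B [seq U k w | k <- iota 1 n.-1]] in
          P (present `&` past) = (P present * P past)%E,
        forall w, T 1 w = edgeless
      & forall n w, 1 <= n -> T n.+1 w = add_edge (T n w) (U n w) n.+1].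

(* Main.v *)
Require Import Defs.
From mathcomp Require Import all_boot all_order all_algebra.
From mathcomp Require Import all_classical all_reals all_analysis.
From mathcomp Require Import zify ring lra.

Import Order.TTheory GRing.Theory Num.Theory.

Local Open Scope classical_set_scope.
Local Open Scope nat_scope.

(* Root T_n at 1.  For a vertex v <> 1 let b(v) be the number of its descendants
   and a(v) the number of vertices outside the branch (subtree hanging from a
   child of the root) that contains v.  If v is ranked before the root, then v
   lies in the largest branch and a(v) <= b(v).

   For fixed v the pair (a, b) is a Polya urn, so b(b+1)g(a) with
   g(a) = 1/((a-1)(a-2)) is a martingale as long as a >= 3; its initial value is
   2g(a), and a(v) starts as a copy of the value at the vertex to which v is
   attached.  Hence, given T_(v-1), P(a(v) <= b(v) at time n) is at most 2W/(v-1),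
   where W = \sum_j g(a(j)), and at time t the quantity (t-1)W is a martingale.
   Summing over v > y, the expected number of v > y ranked before the root is at
   most 2W(T_y) when all a(j) >= 3 at time y.

   Finally, with the convention a(1) = t, exactly one vertex on average has
   a(j) = k, for each k <= t.  So E W <= 1, and some a(j) <= 2 has probability at
   most 2/(y-2), since then y-2 vertices have this property.  Take y = x/2. *)

(** * Histories, and the sizes of branches and of sets of descendants *)

(* A history lists the attachment points U_(n-1), ..., U_1 of the vertices n, ..., 2. *)
Fixpoint history_tree (s : seq nat) : rel nat :=
  if s is u :: s' then add_edge (history_tree s') u (size s').+2 else edgeless.

Fixpoint valid_history (s : seq nat) : bool :=
  if s is u :: s' then (0 < u <= (size s').+1) && valid_history s' else true.

Fixpoint parent (s : seq nat) (j : nat) : nat :=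
  if s is u :: s' then if j == (size s').+2 then u else parent s' j else 0.

Fixpoint below (s : seq nat) (i j : nat) : bool :=
  if s is u :: s' then
    if j == (size s').+2 then (i == j) || below s' i u else below s' i j
  else (i == 1) && (j == 1).

(* The ancestor of j that is a child of the root; 1 when j is the root. *)
Fixpoint branch (s : seq nat) (j : nat) : nat :=
  if s is u :: s' then
    if j == (size s').+2 then if u == 1 then j else branch s' u
    else branch s' j
  else 1.

(* For the root j = 1 this holds for every vertex k: a new child of the root and
   a new descendant of j > 1 then both inherit the outside_size of their parent. *)
Definition outside (s : seq nat) (j k : nat) : bool :=
  (k == 1) || (branch s k != branch s j).

Local Notation tree_vertices s := (vertices (size s).+1).

Definition below_size (s : seq nat) (i : nat) : nat :=
  count (below s i) (tree_vertices s).

Definition outside_size (s : seq nat) (j : nat) : nat :=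
  count (outside s j) (tree_vertices s).

Lemma mem_vertices n k : (k \in vertices n) = (0 < k <= n).
Proof. by rewrite mem_iota add1n ltnS. Qed.

Lemma verticesS n : vertices n.+1 = rcons (vertices n) n.+1.
Proof. by rewrite /vertices -cats1 -(addn1 n) iotaD add1n addn1. Qed.

Lemma tree_vertices_cons u (s : seq nat) :
  tree_vertices (u :: s) = tree_vertices s ++ [:: (size s).+2].
Proof. by rewrite verticesS cats1. Qed.

Lemma below_range s i j : below s i j -> 0 < i <= (size s).+1.
Proof.
elim: s j => [|u s IH] j /=; first by case/andP=> /eqP->.
case: eqP => [->|_]; last by move=> /IH; lia.
by case/orP => [/eqP->|/IH]; lia.
Qed.

Lemma below_refl s i : i \in tree_vertices s -> below s i i.
Proof.
rewrite mem_vertices; elim: s => [|u s IH] /=; first by lia.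
by case: eqP => [|ne] //= h; [rewrite eqxx | apply: IH; lia].
Qed.

Lemma below_root s i : valid_history s -> below s i 1 = (i == 1).
Proof. by elim: s => [|u s IH] /=; [rewrite andbT | case/andP]. Qed.

Lemma branch_le s j : valid_history s -> branch s j <= (size s).+1.
Proof.
elim: s j => //= u s IH j /andP[u_in vs].
case: eqP => [->|_]; last by apply: leqW; exact: IH.
by case: eqP => _ //; apply: leqW; exact: IH.
Qed.

Lemma branch_root s : branch s 1 = 1.
Proof. by elim: s. Qed.

Lemma branch_neq1 s j : valid_history s -> 1 < j <= (size s).+1 -> branch s j != 1.
Proof.
elim: s j => [|u s IH] j /=; first by lia.
case/andP=> u_in vs j_in.
case: (eqVneq j (size s).+2) => [_|ne]; last by apply: IH => //; lia.
by case: (eqVneq u 1) => [_|u1]; [lia | apply: IH => //; lia].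
Qed.

Lemma below_inside s i j : valid_history s -> 1 < i -> below s i j -> ~~ outside s i j.
Proof.
rewrite /outside => vs i1 bij.
have jn1 : j != 1.
  by apply: contraTneq bij => ->; rewrite below_root //; lia.
rewrite (negbTE jn1) /= negbK.
elim: s j vs bij {jn1} => [|u s IH] j /=; first by lia.
case/andP=> u_in vs.
case: (eqVneq j (size s).+2) => [->|ne].
  case/orP => [/eqP ->|biu]; first by rewrite eqxx.
  have -> : (u == 1) = false.
    by apply: contraTF biu => /eqP->; rewrite below_root //; lia.
  have i_in := below_range _ _ _ biu.
  have -> : (i == (size s).+2) = false by lia.
  exact: IH.
move=> bij; have i_in := below_range _ _ _ bij.
have -> : (i == (size s).+2) = false by lia.
exact: IH.
Qed.

(** The new vertex inherits the status of its parent [u]. Attached to the root, it opens a branch of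
    its own and so is outside every older branch, just as the root is. *)
Lemma outside_size_step s u j : valid_history (u :: s) -> j \in tree_vertices s ->
  outside_size (u :: s) j = outside_size s j + outside s j u.
Proof.
rewrite mem_vertices => /andP[u_in vs] j_in.
rewrite /outside_size tree_vertices_cons count_cat [count _ [:: _]]/= addn0.
have jn : (j == (size s).+2) = false by lia.
congr (_ + nat_of_bool _).
  apply: eq_in_count => k; rewrite mem_vertices => k_in.
  rewrite /outside /= jn.
  by have -> : (k == (size s).+2) = false by lia.
rewrite /outside /= jn eqxx.
by case: (eqVneq u 1) => //= _; rewrite gtn_eqF // ltnS branch_le.
Qed.

(** For [u != 1] the branch of [u] is joined. For [u = 1] the new vertex is alone in its branch and
    has all older vertices outside, which is the value that the convention gives to the root. *)
Lemma outside_size_new s u : valid_history (u :: s) ->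
  outside_size (u :: s) (size s).+2 = outside_size s u.
Proof.
case/andP=> u_in vs.
rewrite /outside_size tree_vertices_cons count_cat [count _ [:: _]]/= addn0.
have -> : outside (u :: s) (size s).+2 (size s).+2 = false by rewrite /outside eqxx.
rewrite addn0.
apply: eq_in_count => k; rewrite mem_vertices => k_in.
rewrite /outside /= eqxx.
have -> : (k == (size s).+2) = false by lia.
case: (eqVneq k 1) => //= kn1.
case: (eqVneq u 1) => // ->; rewrite branch_root branch_neq1 //; last by lia.
by rewrite ltn_eqF // ltnS branch_le.
Qed.

Lemma below_size_step s u i : valid_history (u :: s) -> i \in tree_vertices s ->
  below_size (u :: s) i = below_size s i + below s i u.
Proof.
rewrite mem_vertices => /andP[u_in vs] i_in.
rewrite /below_size tree_vertices_cons count_cat [count _ [:: _]]/= addn0 eqxx.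
have -> : (i == (size s).+2) = false by lia.
congr (_ + _); apply: eq_in_count => k; rewrite mem_vertices => k_in.
by rewrite /=; have -> : (k == (size s).+2) = false by lia.
Qed.

Lemma below_size_new s u : below_size (u :: s) (size s).+2 = 1.
Proof.
rewrite /below_size tree_vertices_cons count_cat [count _ [:: _]]/= !eqxx.
suff -> : count (below (u :: s) (size s).+2) (tree_vertices s) = 0 by [].
apply/eqP; rewrite -leqn0 leqNgt -has_count; apply/hasPn => k.
rewrite mem_vertices => k_in /=.
have -> : (k == (size s).+2) = false by lia.
by apply/negP => /below_range; lia.
Qed.

Lemma outside_sizeD_below_size s i : valid_history s -> 1 < i ->
  outside_size s i + below_size s i <= (size s).+1.
Proof.
move=> vs i1; rewrite -[X in _ <= X](size_iota 1) /outside_size /below_size.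
rewrite -count_predUI.
rewrite [X in _ + X](@eq_count _ _ pred0) ?count_pred0 ?addn0 ?count_size //.
move=> k /=; apply/negP => /andP[ok bk].
by have := below_inside _ _ _ vs i1 bk; rewrite ok.
Qed.

(** * Simple paths in the tree of a history *)

Lemma history_tree_sym s : symmetric (history_tree s).
Proof.
elim: s => [|u s IH] x y //=; rewrite /add_edge IH; congr (_ || _).
by rewrite orbC [(y == u) && _]andbC [(x == u) && _]andbC.
Qed.

Lemma history_tree_vertices s x y : valid_history s -> history_tree s x y ->
  x \in tree_vertices s.
Proof.
rewrite mem_vertices; elim: s => [|u s IH] //= /andP[u_in vs].
by case/or3P => [/(IH vs)|/andP[/eqP-> _]|/andP[/eqP -> _]]; lia.
Qed.

Lemma parentP s i : valid_history s -> 1 < i <= (size s).+1 ->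
  [/\ 0 < parent s i < i, history_tree s (parent s i) i & ~~ below s i (parent s i)].
Proof.
elim: s => [|u s IH] /=; first by lia.
case/andP=> u_in vs i_in; rewrite /add_edge.
case: (eqVneq i (size s).+2) => [->|ne].
  rewrite !eqxx orbT; split=> //.
  have -> : (u == (size s).+2) = false by lia.
  by apply/negP => /below_range; lia.
have [p_in e nb] := IH vs ltac:(lia).
rewrite e; split => //.
by have -> : (parent s i == (size s).+2) = false by lia.
Qed.

(** Every edge joins a vertex to its parent, and a vertex other than [u] lies below [u] exactly when
    its parent does; so only the edge above [u] can cross. *)
Lemma below_boundary s u x y : valid_history s -> history_tree s x y ->
  below s u y -> ~~ below s u x -> y = u /\ x = parent s u.
Proof.
elim: s u x y => [|v s IH] u x y //= /andP[v_in vs].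
case/or3P => [e|/andP[/eqP-> /eqP->]|/andP[/eqP -> /eqP ->]].
- have := history_tree_vertices _ _ _ vs e.
  rewrite history_tree_sym in e.
  have := history_tree_vertices _ _ _ vs e.
  rewrite history_tree_sym in e.
  rewrite !mem_vertices => y_in x_in.
  have -> : (y == (size s).+2) = false by lia.
  have -> : (x == (size s).+2) = false by lia.
  move=> by_ nbx; have [-> ->] := IH _ _ _ vs e by_ nbx.
  have := below_range _ _ _ by_.
  by case: eqP => [|//]; lia.
- rewrite eqxx; have -> : (v == (size s).+2) = false by lia.
  by case/orP => [/eqP->|->]; rewrite ?eqxx.
- rewrite eqxx; have -> : (v == (size s).+2) = false by lia.
  by move=> ->; rewrite orbT.
Qed.

Lemma avoid_below s u x p : valid_history s -> ~~ below s u x ->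
  path (history_tree s) x p -> u \notin p -> all (fun z => ~~ below s u z) (x :: p).
Proof.
move=> vs; elim: p x => [|y p IH] x nbx /=; first by rewrite nbx.
case/andP=> e pth; rewrite inE negb_or => /andP[uy up]; rewrite nbx /=.
apply: IH => //; apply/negP => by_.
by have [yu _] := below_boundary _ _ _ _ vs e by_ nbx; rewrite yu eqxx in uy.
Qed.

(** If [w] were not below [u], both ends of the path would lie outside the subtree of [u], so the
    path would reach [u] from its parent and leave it to its parent, repeating a vertex. *)
Lemma on_path_root_below s u w : valid_history s -> u \in tree_vertices s -> u != 1 ->
  on_path (history_tree s) w 1 u -> below s u w.
Proof.
move=> vs u_in u1 /asboolP[p [pth unq lst mem]].
apply/negPn/negP => nbw.
have wu : u != w by apply: contraNneq nbw => <-; exact: below_refl.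
move: mem; rewrite inE (negbTE wu) /= => mem.
case/splitPr: mem pth unq lst => p1 p2.
rewrite cat_path last_cat /= => /and3P[pth1 e1 pth2] unq lst.
have up1 : u \notin p1.
  by move: unq; rewrite cat_uniq /= negb_or => /andP[_ /and4P[_ /andP[]]].
have up2 : u \notin p2.
  by move: unq; rewrite cat_uniq /= => /and5P[].
have /allP nb1 := avoid_below _ _ _ _ vs nbw pth1 up1.
have [_ z1] := below_boundary _ _ _ _ vs e1 (below_refl _ _ u_in) (nb1 _ (mem_last _ _)).
case: p2 pth2 up2 lst unq => [|z p2] /=; first by move=> _ _ lst; rewrite lst eqxx in u1.
case/andP=> e2 pth2; rewrite inE negb_or => /andP[uz up2] lst unq.
have nb : ~~ below s u 1 by rewrite below_root.
(* The second half is read backwards from the root, so that [avoid_below] applies to it too. *)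
have pth2' : path (history_tree s) 1 (rev (belast z p2)).
  rewrite -lst rev_path (eq_path (e' := history_tree s)) // => ? ?.
  exact: history_tree_sym.
have upr : u \notin rev (belast z p2).
  rewrite mem_rev; apply/negP => /mem_belast; rewrite inE (negbTE uz) /=.
  by rewrite (negbTE up2).
have /allP nb2 := avoid_below _ _ _ _ vs nb pth2' upr.
have zin : z \in 1 :: rev (belast z p2).
  by rewrite -lst -rev_rcons mem_rev -lastI mem_head.
rewrite history_tree_sym in e2.
have [_ z2] := below_boundary _ _ _ _ vs e2 (below_refl _ _ u_in) (nb2 _ zin).
have : uniq ((w :: p1) ++ [:: u, z & p2]) by [].
rewrite cat_uniq => /and3P[_ /hasPn disj _].
have := disj z; rewrite !inE eqxx orbT => /(_ isT).
by rewrite /= z2 -z1 -in_cons mem_last.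
Qed.

Lemma below_parent s i j : valid_history s -> 1 < j <= (size s).+1 ->
  below s i j = (i == j) || below s i (parent s j).
Proof.
elim: s => [|u s IH] /=; first by lia.
case/andP=> u_in vs j_in.
case: (eqVneq j (size s).+2) => [_|ne].
  by have -> : (u == (size s).+2) = false by lia.
have j_in' : 1 < j <= (size s).+1 by lia.
have [p_in _ _] := parentP _ _ vs j_in'.
have -> : (parent s j == (size s).+2) = false by lia.
exact: IH.
Qed.

(** The path climbs through the ancestors of [w]; the last clause keeps it out of the subtree of any
    [i] that is not above [w]. *)
Lemma path_to_root s w : valid_history s -> w \in tree_vertices s ->
  exists2 p, path (history_tree s) w p & last w p = 1 /\
    forall i z, z \in w :: p -> below s i z -> below s i w.
Proof.
move=> vs; elim/ltn_ind: w => w IH; rewrite mem_vertices => w_in.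
case: (eqVneq w 1) => [->|w1].
  by exists [::] => //; split=> // i z; rewrite mem_seq1 => /eqP->.
have w_in' : 1 < w <= (size s).+1 by lia.
have [p_in e _] := parentP _ _ vs w_in'.
have [||p pth [lst bl]] := IH (parent s w); rewrite ?mem_vertices; try lia.
exists (parent s w :: p) => /=; first by rewrite history_tree_sym e.
split=> // i z; rewrite inE => /orP[/eqP->//|zp] /(bl _ _ zp) biw.
by rewrite below_parent // biw orbT.
Qed.

(** Climb from [w] to the root, then descend to the parent of [v]; neither half meets the subtree of
    [v]. Shorten this walk to a simple path and append [v]. *)
Lemma on_path_above s v w : valid_history s -> v \in tree_vertices s -> v != 1 ->
  w \in tree_vertices s -> ~~ below s v w ->
  on_path (history_tree s) w v (parent s v).
Proof.
move=> vs v_in v1 w_in nbw.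
have v_in' : 1 < v <= (size s).+1 by move: v_in; rewrite mem_vertices; lia.
have [p_in e nbp] := parentP _ _ vs v_in'.
have [q pthq [lstq blq]] := path_to_root _ _ vs w_in.
have [|r pthr [lstr blr]] := path_to_root s (parent s v) vs.
  by rewrite mem_vertices; lia.
pose t := q ++ rev (belast (parent s v) r).
have ptht : path (history_tree s) w t.
  rewrite cat_path pthq lstq -lstr rev_path.
  by rewrite (eq_path (e' := history_tree s)) // => ? ?; exact: history_tree_sym.
have lstt : last w t = parent s v.
  rewrite last_cat lstq -lstr.
  by case: (r) => //= z r'; rewrite rev_cons last_rcons.
have nbt z : z \in w :: t -> ~~ below s v z.
  rewrite /t -cat_cons mem_cat => /orP[zq|]; first by apply: contra nbw; exact: blq.
  by rewrite mem_rev => /mem_belast zr; apply: contra nbp; exact: blr.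
case/shortenP: ptht lstt => t' ptht' unq sub lstt.
have vt : v \notin w :: t'.
  apply/negP => vt; have vt' : v \in w :: t.
    by move: vt; rewrite !inE => /orP[->|/sub ->]; rewrite ?orbT.
  by move: (nbt _ vt'); rewrite below_refl.
apply/asboolP; exists (rcons t' v); split.
- by rewrite rcons_path ptht' lstt.
- by rewrite -rcons_cons rcons_uniq vt.
- by rewrite last_rcons.
- by rewrite -rcons_cons mem_rcons inE -lstt mem_last orbT.
Qed.

(** * Jordan centrality and the rank of the root *)

Lemma jordan_root_le s : valid_history s ->
  jordan (size s).+1 (history_tree s) 1 <=
    \max_(u <- tree_vertices s | u != 1) below_size s u.
Proof.
move=> vs; apply/bigmax_leqP_seq => u u_in u1.
apply: (bigmaxn_sup_seq u) => //.
rewrite size_filter; apply: sub_count => w.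
exact: on_path_root_below.
Qed.

(** The maximum is bounded below by its term at the parent of [v], behind which, seen from [v], lies
    everything that is not below [v]. *)
Lemma jordan_ge s v : valid_history s -> v \in tree_vertices s -> v != 1 ->
  (size s).+1 <= jordan (size s).+1 (history_tree s) v + below_size s v.
Proof.
move=> vs v_in v1.
have v_in' : 1 < v <= (size s).+1 by move: v_in; rewrite mem_vertices; lia.
have [p_in e nbp] := parentP _ _ vs v_in'.
have : size (subtree (size s).+1 (history_tree s) v (parent s v))
    <= jordan (size s).+1 (history_tree s) v.
  rewrite /jordan; apply: leq_bigmax_seq; last by lia.
  by rewrite mem_vertices; lia.
suff : (size s).+1 - below_size s v <=
    size (subtree (size s).+1 (history_tree s) v (parent s v)) by lia.
rewrite -{1}[(size s).+1](size_iota 1) -(count_predC (below s v)) addKn.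
rewrite size_filter (eq_in_count
  (a2 := predI (predC (below s v)) (mem (tree_vertices s)))); last first.
  by move=> k k_in /=; rewrite k_in andbT.
apply: sub_count => w /andP[nb w_in].
exact: on_path_above.
Qed.

(** In a common branch, the vertices outside it are disjoint from those below [u], which leaves at
    most [below_size s v] of them. In different branches, the root and the two subtrees would be
    disjoint and have more than [(size s).+1] vertices together. *)
Lemma outside_size_le_below_size s u v : valid_history s -> u \in tree_vertices s ->
  v \in tree_vertices s -> u != 1 -> v != 1 ->
  (size s).+1 <= below_size s u + below_size s v ->
  outside_size s v <= below_size s v.
Proof.
move=> vs; rewrite !mem_vertices => u_in v_in u1 v1 le_n.
have u_gt : 1 < u by lia.
have v_gt : 1 < v by lia.
case: (eqVneq (branch s u) (branch s v)) => [eq_br|ne_br].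
  have out_eq : outside_size s v = outside_size s u.
    by apply: eq_count => k; rewrite /outside eq_br.
  by have := outside_sizeD_below_size _ _ vs u_gt; lia.
suff : 1 + below_size s v <= outside_size s u.
  by have := outside_sizeD_below_size _ _ vs u_gt; lia.
have -> : 1 = count (pred1 1) (tree_vertices s).
  by rewrite count_uniq_mem ?iota_uniq ?mem_vertices.
rewrite /below_size -count_predUI.
rewrite [X in _ + X](@eq_count _ _ pred0) ?count_pred0 ?addn0; last first.
  by move=> k /=; apply/negP => /andP[/eqP -> ]; rewrite below_root // (negbTE v1).
apply: sub_count => k /=; rewrite /outside => /orP[->//|bvk].
have := below_inside _ _ _ vs v_gt bvk.
rewrite /outside negb_or negbK => /andP[_ /eqP ->].
by rewrite [branch s v == _]eq_sym ne_br orbT.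
Qed.

(** By [jordan_ge] and [jordan_root_le], some [u != 1] must satisfy the size hypothesis of
    [outside_size_le_below_size]. *)
Lemma jordan_le_root s v : valid_history s -> v \in tree_vertices s -> v != 1 ->
  jordan (size s).+1 (history_tree s) v <= jordan (size s).+1 (history_tree s) 1 ->
  outside_size s v <= below_size s v.
Proof.
move=> vs v_in v1 le_vr.
have [/hasP[u u_in /andP[u1 le_n]]|/hasPn lt_n] := boolP (has
    (fun u => (u != 1) && ((size s).+1 <= below_size s u + below_size s v))
    (tree_vertices s)).
  exact: (outside_size_le_below_size _ u).
have lt_max : \max_(u <- tree_vertices s | u != 1) below_size s u <=
    size s - below_size s v.
  by apply/bigmax_leqP_seq => u u_in u1; have := lt_n _ u_in; rewrite u1 /=; lia.
(* Taking [u = v] in [lt_n] shows that the subtraction in [lt_max] does not truncate. *)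
have := jordan_root_le s vs; have := jordan_ge _ _ vs v_in v1.
by have := lt_n _ v_in; rewrite v1 /=; lia.
Qed.

Lemma jordan_rank_root_le s y : valid_history s -> 0 < y ->
  jordan_rank (size s).+1 (history_tree s) 1 <=
    y + count (fun v => (y < v) && (outside_size s v <= below_size s v))
      (tree_vertices s).
Proof.
move=> vs y0; rewrite /jordan_rank.
set r := ranked_before _ _; set L := sort r _.
have r_total : total r by move=> a b; rewrite /r /ranked_before; lia.
have r_trans : transitive r by move=> a b c; rewrite /r /ranked_before; lia.
have L_sorted : sorted r L by exact: sort_sorted.
have L_perm : perm_eq L (tree_vertices s) by rewrite perm_sort.
have L1 : 1 \in L by rewrite (perm_mem L_perm) mem_vertices.
have L1u : uniq L by rewrite (perm_uniq L_perm) iota_uniq.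
clearbody L; case/splitPr: L1 L_sorted L_perm L1u => T D.
rewrite sorted_pairwise // pairwise_cat => /and3P[/allrelP rT _ _] L_perm L1u.
have T1 : 1 \notin T.
  by move: L1u; rewrite cat_uniq /= negb_or => /and3P[_ /andP[]].
have -> : index 1 (T ++ 1 :: D) = size T by rewrite index_cat (negbTE T1) /= addn0.
(* Counting the root together with the vertices before it absorbs the successor: the root is one of
   the [y] labels up to [y]. *)
have -> : (size T).+1 = size (rcons T 1) by rewrite size_rcons.
rewrite -(count_predC (fun v => v <= y) (rcons T 1)); apply: leq_add.
  rewrite -size_filter -[X in _ <= X](size_iota 1); apply: uniq_leq_size.
    apply: filter_uniq; rewrite -cats1.
    by move: L1u; rewrite -[1 :: D]cat1s catA cat_uniq => /andP[].
  move=> k; rewrite mem_filter => /andP[ky kT]; rewrite mem_iota add1n ltnS ky andbT.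
  have : k \in T ++ 1 :: D.
    by move: kT; rewrite mem_rcons mem_cat !inE => /orP[->|->]; rewrite ?orbT.
  by rewrite (perm_mem L_perm) mem_vertices => /andP[].
rewrite -cats1 count_cat.
have -> : count (predC (leq^~ y)) [:: 1] = 0 by rewrite /= y0.
rewrite addn0.
rewrite -(permP L_perm) count_cat.
apply: leq_trans (leq_addr _ _).
rewrite -[X in X <= _]size_filter -[X in _ <= X]size_filter.
apply: uniq_leq_size; first by apply: filter_uniq; move: L1u; rewrite cat_uniq => /andP[].
move=> k; rewrite !mem_filter /= -ltnNge => /andP[yk kT].
rewrite yk kT andbT.
have k_in : k \in tree_vertices s by rewrite -(perm_mem L_perm) mem_cat kT.
have k1 : k != 1 by apply: contraNneq T1 => <-.
apply: jordan_le_root => //.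
have := rT _ _ kT (mem_head _ _).
by rewrite /r /ranked_before; lia.
Qed.

(** * Conditional expectations over the growing tree *)

Local Open Scope ring_scope.

(* The conditional expectation of f after k more vertices are attached to s. *)
Fixpoint growth {R : realType} (k : nat) (s : seq nat) (f : seq nat -> R) : R :=
  if k is k'.+1 then
    (size s).+1%:R^-1 * \sum_(u <- tree_vertices s) growth k' (u :: s) f
  else f s.

Definition growth_closed (Q : pred (seq nat)) :=
  forall s u, Q s -> u \in tree_vertices s -> Q (u :: s).

Lemma valid_history_closed : growth_closed valid_history.
Proof. by move=> s u vs; rewrite mem_vertices /= vs andbT. Qed.

Lemma growth_le {R : realType} (Q : pred (seq nat)) k s (f g : seq nat -> R) :
  growth_closed Q -> Q s ->
  (forall s', Q s' -> size s' = (k + size s)%N -> f s' <= g s') ->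
  growth k s f <= growth k s g.
Proof.
move=> Qc; elim: k s => [|k IH] s Qs le_fg /=; first exact: le_fg.
rewrite ler_wpM2l ?invr_ge0 ?ler0n // big_seq [leRHS]big_seq.
apply: ler_sum => u u_in; apply: IH; first exact: Qc.
by move=> s' Qs' sz; apply: le_fg; rewrite // sz /= addnS.
Qed.

Lemma growth_eq {R : realType} k s (f g : seq nat -> R) : valid_history s ->
  (forall s', valid_history s' -> size s' = (k + size s)%N -> f s' = g s') ->
  growth k s f = growth k s g.
Proof.
move=> vs eq_fg; apply/eqP; rewrite eq_le.
by rewrite !(growth_le valid_history) // => [|||] //; try exact: valid_history_closed;
  move=> s' vs' sz; rewrite eq_fg.
Qed.

Lemma growth_add {R : realType} k l s (f : seq nat -> R) :
  growth (k + l) s f = growth k s (fun s' => growth l s' f).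
Proof.
elim: k s => //= k IH s; congr (_ * _).
by apply: eq_bigr => u _; rewrite IH.
Qed.

Lemma growthZ {R : realType} k s c (f : seq nat -> R) :
  growth k s (fun s' => c * f s') = c * growth k s f.
Proof.
elim: k s => //= k IH s; under eq_bigr do rewrite IH.
by rewrite -mulr_sumr mulrCA.
Qed.

Lemma growthD {R : realType} k s (f g : seq nat -> R) :
  growth k s (fun s' => f s' + g s') = growth k s f + growth k s g.
Proof.
elim: k s => //= k IH s; rewrite -mulrDr -big_split; congr (_ * _).
by apply: eq_bigr => u _; rewrite IH.
Qed.

Lemma growth_sum {R : realType} (I : Type) (r : seq I) k s (F : I -> seq nat -> R) :
  growth k s (fun s' => \sum_(i <- r) F i s') = \sum_(i <- r) growth k s (F i).
Proof.
elim: k s => //= k IH s; rewrite -mulr_sumr exchange_big; congr (_ * _).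
by apply: eq_bigr => u _; rewrite IH.
Qed.

Lemma growth_cst {R : realType} k s (c : R) : growth k s (fun=> c) = c.
Proof.
elim: k s => //= k IH s; under eq_bigr do rewrite IH.
rewrite big_const_seq count_predT size_iota iter_addr_0 -[c *+ _]mulr_natl mulrA.
by rewrite mulVf ?mul1r // pnatr_eq0.
Qed.

Lemma growth_supermartingale {R : realType} (Q : pred (seq nat)) k s (f : seq nat -> R) :
  growth_closed Q -> Q s -> (forall s', Q s' -> growth 1 s' f <= f s') ->
  growth k s f <= f s.
Proof.
move=> Qc Qs le_f; elim: k s Qs => [|k IH] s Qs //=.
apply: le_trans (le_f _ Qs) => /=.
rewrite ler_wpM2l ?invr_ge0 ?ler0n // big_seq [leRHS]big_seq.
by apply: ler_sum => u u_in; apply: IH; exact: Qc.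
Qed.

(** * One-step averages and the mean profile of [outside_size] *)

(** Evaluates an urn step: the attachment vertex is outside the branch of a given vertex, below that
    vertex, or neither, and only this class matters. *)
Lemma sum_disjoint_preds {R : realType} (p q : pred nat) (r : seq nat)
    (F : bool -> bool -> R) : (forall x, ~~ (p x && q x)) ->
  \sum_(x <- r) F (p x) (q x) =
    (count p r)%:R * F true false + (count q r)%:R * F false true +
    ((size r)%:R - (count p r)%:R - (count q r)%:R) * F false false.
Proof.
move=> dis; elim: r => [|x r IH]; first by rewrite big_nil /=; ring.
rewrite big_cons IH /= !natrD -[in (size r).+1%:R]add1n natrD.
by have := dis x; case: (p x); case: (q x) => //= _; ring.
Qed.

Lemma sum_pred {R : realType} (p : pred nat) (r : seq nat) (F : bool -> R) :
  \sum_(x <- r) F (p x) =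
    (count p r)%:R * F true + ((size r)%:R - (count p r)%:R) * F false.
Proof.
rewrite (sum_disjoint_preds p pred0 r (fun b _ => F b)) => [|x]; last by rewrite andbF.
by rewrite count_pred0; ring.
Qed.

(* Zero at k = 1 and k = 2, by the convention 0^-1 = 0. *)
Definition gap_weight {R : realType} (k : nat) : R := ((k%:R - 1) * (k%:R - 2))^-1.

Lemma gap_weight_ge0 {R : realType} k : 0 <= gap_weight k :> R.
Proof.
rewrite invr_ge0; case: k => [|[|k]].
- by rewrite (_ : (_ - 1) * _ = 2) ?ler0n //; ring.
- by rewrite subrr mul0r.
- by rewrite mulr_ge0 // subr_ge0 ler_nat.
Qed.

(** The sum telescopes, as g(i) = 1/(i-2) - 1/(i-1). *)
Lemma gap_weight_sum {R : realType} m K : (2 < m)%N ->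
  \sum_(i <- iota m K) gap_weight i <= (m%:R - 2)^-1 :> R.
Proof.
elim: K m => [|K IH] m m2; first by rewrite big_nil invr_ge0 subr_ge0 ler_nat ltnW.
rewrite big_cons; apply: le_trans (lerD (lexx _) (IH m.+1 _)) _; first by rewrite ltnW.
have m2' : 2 < m%:R :> R by rewrite ltr_nat.
rewrite -[m.+1]addn1 natrD /gap_weight le_eqVlt; apply/orP; left; apply/eqP.
by field; apply/andP; split; [rewrite subr_eq0; apply/eqP|] ; lra.
Qed.

Definition outside_sum {R : realType} (F : nat -> R) (s : seq nat) : R :=
  \sum_(j <- tree_vertices s) F (outside_size s j).

Lemma outside_sum_gap_weight_ge0 {R : realType} s :
  0 <= outside_sum gap_weight s :> R.
Proof. by apply: sumr_ge0 => j _; exact: gap_weight_ge0. Qed.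

(** With t vertices, an old value a becomes a+1 with probability a/t. The new vertex copies the
    value of a uniform vertex, which turns the factor t-a into t+1-a. *)
Lemma growth1_outside_sum {R : realType} (F : nat -> R) s : valid_history s ->
  growth 1 s (outside_sum F) =
    outside_sum (fun a => (a%:R * F a.+1 + ((size s).+2%:R - a%:R) * F a) /
      (size s).+1%:R) s.
Proof.
move=> vs; rewrite /outside_sum /= mulr_sumr.
transitivity ((size s).+1%:R^-1 * \sum_(u <- tree_vertices s)
  (\sum_(j <- tree_vertices s) F (outside_size s j + outside s j u)%N +
   F (outside_size s u))).
  rewrite mulr_sumr big_seq [RHS]big_seq; apply: eq_bigr => u u_in; congr (_ * _).
  have vus := valid_history_closed _ _ vs u_in.
  rewrite (tree_vertices_cons u) big_cat big_seq1 outside_size_new //; congr (_ + _).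
  by rewrite big_seq [RHS]big_seq; apply: eq_bigr => j j_in; rewrite outside_size_step.
rewrite big_split exchange_big /= -big_split mulr_sumr; apply: eq_bigr => j _ /=.
rewrite (sum_pred (outside s j) _ (fun b => F (outside_size s j + b)%N)).
rewrite addn1 addn0 size_iota -/(outside_size s j) -[(size s).+2]addn1 natrD.
rewrite [LHS]mulrC; congr (_ / _); ring.
Qed.

(** For m = t the right side is t times the sum of F over 1, ..., t+1: the step of
    [growth1_outside_sum] preserves the flat profile. *)
Lemma sum_size_biased {R : realType} (F : nat -> R) (t m : nat) :
  \sum_(1 <= i < m.+1) (i%:R * F i.+1 + (t.+1%:R - i%:R) * F i) =
  t%:R * \sum_(1 <= i < m.+1) F i + m%:R * F m.+1.
Proof.
elim: m => [|m IH]; first by rewrite !big_geq //; ring.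
rewrite big_nat_recr //= IH [in RHS]big_nat_recr //= -[t.+1]addn1 -[m.+1]addn1 !natrD.
by ring.
Qed.

(** Induction on [k] with [F] general: the last step is averaged first, which replaces [F] by its
    one-step transform. *)
Lemma growth_outside_sum {R : realType} k (F : nat -> R) :
  growth k [::] (outside_sum F) = \sum_(1 <= i < k.+2) F i.
Proof.
elim: k F => [|k IH] F.
  by rewrite /= /outside_sum big_nat1 big_seq1.
rewrite -addn1 growth_add.
rewrite (growth_eq k [::] _ (outside_sum (fun a =>
    (a%:R * F a.+1 + (k.+2%:R - a%:R) * F a) / k.+1%:R))) // => [|s vs sz]; last first.
  by rewrite growth1_outside_sum // sz addn0.
rewrite IH -mulr_suml sum_size_biased addn1 [in RHS]big_nat_recr //=.
by rewrite -mulrDr mulrC mulKf // pnatr_eq0.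
Qed.

(** * Martingales on spread histories *)

(** Here all denominators in [gap_weight] are positive. The property persists, since [outside_size]
    never decreases and a new vertex copies an old value. *)
Definition spread_history (s : seq nat) : bool :=
  valid_history s && all (fun j => 2 < outside_size s j)%N (tree_vertices s).

Lemma spread_history_closed : growth_closed spread_history.
Proof.
move=> s u /andP[vs /allP sp] u_in.
have vus := valid_history_closed _ _ vs u_in.
apply/andP; split=> //; rewrite (tree_vertices_cons u) all_cat all_seq1.
rewrite outside_size_new // sp // andbT; apply/allP => j j_in.
by rewrite outside_size_step // ltn_addr // sp.
Qed.

Lemma spread_history_size s : spread_history s -> (1 < size s)%N.
Proof.
case/andP=> _ /allP/(_ 1%N); rewrite mem_vertices => /(_ isT) a2.
by have := leq_trans a2 (count_size _ _); rewrite size_iota.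
Qed.

(** Since a g(a+1) = (a-2) g(a), one step at t = [(size s).+1] vertices multiplies the mean of W by
    (t-1)/t, which the prefactor compensates. *)
Lemma growth1_gap_weight {R : realType} s : spread_history s ->
  growth 1 s (fun s' => (size s')%:R * outside_sum gap_weight s' : R) =
  (size s)%:R * outside_sum gap_weight s.
Proof.
case/andP=> vs /allP sp.
have -> : growth 1 s (fun s' => (size s')%:R * outside_sum gap_weight s' : R) =
   growth 1 s (fun s' => (size s).+1%:R * outside_sum gap_weight s').
  by apply: growth_eq => // s' _ ->.
rewrite growthZ growth1_outside_sum // /outside_sum !mulr_sumr big_seq [RHS]big_seq.
apply: eq_bigr => j /sp; set a := outside_size s j => a2.
have a2' : 2 < a%:R :> R by rewrite ltr_nat.
rewrite mulrC divfK ?pnatr_eq0 // /gap_weight; clearbody a.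
rewrite -[a.+1]addn1 -[(size s).+2]addn2 !natrD.
by field; rewrite !subr_eq0; apply/and3P; split; apply/eqP; lra.
Qed.

Definition overtaking_weight {R : realType} (i : nat) (s : seq nat) : R :=
  (below_size s i)%:R * (below_size s i).+1%:R * gap_weight (outside_size s i).

(** With probability b/t the weight is multiplied by (b+2)/b, with probability a/t by (a-2)/a; the
    gain 2/t and the loss 2/t cancel. *)
Lemma growth1_overtaking_weight {R : realType} i s : spread_history s ->
  i \in tree_vertices s -> i != 1%N ->
  growth 1 s (overtaking_weight i) = overtaking_weight i s :> R.
Proof.
case/andP=> vs /allP sp i_in i1; rewrite /=.
have i_gt : (1 < i)%N by move: i_in; rewrite mem_vertices; lia.
have := sp _ i_in; set a := outside_size s i => a2.
have a2' : 2 < a%:R :> R by rewrite ltr_nat.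
pose b := below_size s i.
pose F (x y : bool) : R := (b + y)%:R * (b + y).+1%:R * gap_weight (a + x).
transitivity ((size s).+1%:R^-1 *
    \sum_(u <- tree_vertices s) F (outside s i u) (below s i u)).
  congr (_ * _); rewrite big_seq [RHS]big_seq; apply: eq_bigr => u u_in.
  have vus := valid_history_closed _ _ vs u_in.
  by rewrite /overtaking_weight below_size_step // outside_size_step.
rewrite (sum_disjoint_preds _ _ _ F) => [|u]; last first.
  by apply/negP => /andP[ou bu]; have := below_inside _ _ _ vs i_gt bu; rewrite ou.
rewrite -/(outside_size s i) -/(below_size s i) -/a -/b size_iota /F.
rewrite /overtaking_weight -/a -/b /gap_weight !addn1 !addn0; clearbody a b.
rewrite -[a.+1]addn1 -[b.+2]addn2 -[b.+1]addn1 -[(size s).+1]addn1 !natrD.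
have s0 : 0 <= (size s)%:R :> R by [].
set m := (size s)%:R in s0 *; clearbody m.
by field; do ?(apply/andP; split); apply/eqP; lra.
Qed.

Definition overtakes (i : nat) (s : seq nat) : bool :=
  (outside_size s i <= below_size s i)%N.

(** * Probabilities of overtaking the root *)

(** If a <= b then b(b+1) >= (a-1)(a-2), so the weight is at least 1; this turns the martingale into
    a probability bound. *)
Lemma overtakes_le_weight {R : realType} i s : (2 < outside_size s i)%N ->
  (overtakes i s)%:R <= overtaking_weight i s :> R.
Proof.
rewrite /overtakes /overtaking_weight.
set a := outside_size s i; set b := below_size s i; clearbody a b => a2.
have a2' : 2 < a%:R :> R by rewrite ltr_nat.
case: (leqP a b) => ab /=; last by rewrite mulr_ge0 ?gap_weight_ge0 // mulr_ge0.
have ab' : a%:R <= b%:R :> R by rewrite ler_nat.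
rewrite /gap_weight ler_pdivlMr; last by rewrite mulr_gt0 // subr_gt0; lra.
by rewrite mul1r -addn1 natrD; nra.
Qed.

Lemma growth_overtakes_new {R : realType} l s : spread_history s ->
  growth l.+1 s (fun s' => (overtakes (size s).+2 s')%:R : R) <=
  2 / (size s).+1%:R * outside_sum gap_weight s.
Proof.
move=> sps; have [vs _] := andP sps.
rewrite /= [2 / _]mulrC -mulrA ler_wpM2l ?invr_ge0 ?ler0n //.
rewrite /outside_sum mulr_sumr big_seq [leRHS]big_seq; apply: ler_sum => u u_in.
have vus := valid_history_closed _ _ vs u_in.
have spus := spread_history_closed _ _ sps u_in.
(* The martingale identity needs the vertex to be present, so its presence joins the invariant. *)
pose Q s' := spread_history s' && ((size s).+2 \in tree_vertices s').
have Qc : growth_closed Q.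
  move=> s' v /andP[sp' i_in] v_in; apply/andP; split.
    exact: spread_history_closed.
  by rewrite (tree_vertices_cons v) mem_cat i_in.
have Qus : Q (u :: s) by rewrite /Q spus mem_vertices /= ltnS leqnn.
apply: (@le_trans _ _ (growth l (u :: s) (overtaking_weight (size s).+2))).
  apply: (growth_le Q) => // s' /andP[/andP[_ /allP sp'] /sp' a2] _.
  exact: overtakes_le_weight.
apply: le_trans (growth_supermartingale Q _ _ _ Qc Qus _) _.
  by move=> s' /andP[sp' i_in]; rewrite growth1_overtaking_weight.
by rewrite /overtaking_weight below_size_new outside_size_new // mul1r.
Qed.

(** The vertex is born just after the history has reached size t = [size s + k]. There
    [growth_overtakes_new] gives 2W/(t+1) = 2(tW)/(t(t+1)), where tW is the martingale of
    [growth1_gap_weight] and 1/(t(t+1)) = g(t+2). *)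
Lemma growth_overtakes {R : realType} k l s : spread_history s ->
  growth (k + l.+1) s (fun s' => (overtakes (size s + k).+2 s')%:R : R) <=
  2 * ((size s)%:R * outside_sum gap_weight s) * gap_weight (size s + k).+2.
Proof.
move=> sps; rewrite growth_add.
have s1 : 1 < (size s)%:R :> R by rewrite ltr1n spread_history_size.
have k0 : 0 <= k%:R :> R by [].
set t := (size s + k)%N; set c := 2 * gap_weight t.+2 : R.
have -> : 2 * ((size s)%:R * outside_sum gap_weight s) * gap_weight t.+2 =
    c * ((size s)%:R * outside_sum gap_weight s) by rewrite /c; ring.
apply: (@le_trans _ _ (growth k s (fun s' =>
    c * ((size s')%:R * outside_sum gap_weight s')))).
  apply: (growth_le spread_history) => //; first exact: spread_history_closed.
  move=> s' sp' sz.
  have tE : size s' = t by rewrite sz addnC.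
  have := growth_overtakes_new l _ sp' => /(_ R); rewrite tE.
  move/le_trans; apply; rewrite mulrA; apply: ler_wpM2r.
    exact: outside_sum_gap_weight_ge0.
  rewrite le_eqVlt; apply/orP; left; apply/eqP.
  rewrite /c /gap_weight -[t.+2]addn2 -[t.+1]addn1 /t !natrD.
  set m := (size s)%:R in s1 *; set k' := k%:R in k0 *; clearbody m k'.
  by field; rewrite ?subr_eq0; do ?(apply/andP; split); apply/eqP; lra.
rewrite growthZ ler_wpM2l //; first by rewrite /c mulr_ge0 ?gap_weight_ge0.
apply: (growth_supermartingale spread_history) => //; first exact: spread_history_closed.
by move=> s' sp'; rewrite growth1_gap_weight.
Qed.

Lemma growth_overtakes_count {R : realType} k s : spread_history s ->
  growth k s (fun s' => (count (fun v => ((size s).+1 < v)%N && overtakes v s')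
    (tree_vertices s'))%:R : R) <= 2 * outside_sum gap_weight s.
Proof.
move=> sps; have [vs /allP sp] := andP sps.
have s1 := spread_history_size _ sps.
have W0 : 0 <= outside_sum gap_weight s :> R := outside_sum_gap_weight_ge0 s.
apply: (@le_trans _ _ (growth k s (fun s' =>
    \sum_(i <- iota (size s).+2 k) (overtakes i s')%:R))).
  apply: (growth_le valid_history) => //; first exact: valid_history_closed.
  move=> s' vs' sz.
  have -> : tree_vertices s' = tree_vertices s ++ iota (size s).+2 k.
    by rewrite sz /vertices addnC -addSn iotaD add1n.
  rewrite count_cat (_ : count _ (tree_vertices s) = 0%N); last first.
    apply/eqP; rewrite -leqn0 leqNgt -has_count; apply/hasPn => v.
    by rewrite mem_vertices => /andP[_ v_le]; rewrite ltnNge v_le.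
  rewrite add0n -sum1_count natr_sum big_mkcond; apply: ler_sum => i _.
  by case: ifP => // /andP[_ ->].
rewrite growth_sum; apply: (@le_trans _ _ (\sum_(i <- iota (size s).+2 k)
    2 * ((size s)%:R * outside_sum gap_weight s) * gap_weight i)).
  rewrite big_seq [leRHS]big_seq; apply: ler_sum => i; rewrite mem_iota => i_in.
  (* Vertex [i] is born at step [l + 1], and [(k - l).-1] steps follow. *)
  have -> : i = (size s + (i - (size s).+2)).+2 by lia.
  set l := (i - (size s).+2)%N.
  have -> : k = (l + (k - l).-1.+1)%N by lia.
  exact: growth_overtakes.
have le_sum : \sum_(i <- iota (size s).+2 k) gap_weight i <= ((size s).+2%:R - 2)^-1 :> R.
  by apply: gap_weight_sum; lia.
rewrite -mulr_sumr.
have -> : 2 * outside_sum gap_weight s =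
   2 * ((size s)%:R * outside_sum gap_weight s) * ((size s).+2%:R - 2)^-1 :> R.
  rewrite -[(size s).+2]addn2 natrD addrK -mulrA; congr (_ * _).
  by rewrite mulrAC mulfV ?mul1r // pnatr_eq0; lia.
by rewrite ler_wpM2l // !mulr_ge0.
Qed.

(** * The tail bound for growing histories *)

(** Markov's inequality for the number of vertices with value at most 2, whose mean is 2. If [j] is
    one, then so is its whole branch, which misses at most two of the [k.+1] vertices. *)
Lemma growth_not_spread {R : realType} k : (1 < k)%N ->
  growth k [::] (fun s => (~~ spread_history s)%:R : R) <= 2 / (k.-1)%:R.
Proof.
move=> k1; have k1' : 0 < (k.-1)%:R :> R by rewrite ltr0n; lia.
rewrite ler_pdivlMr // mulrC -growthZ.
apply: (@le_trans _ _ (growth k [::] (outside_sum (fun a => (a <= 2)%N%:R)))).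
  apply: (growth_le valid_history) => //; first exact: valid_history_closed.
  move=> s vs; rewrite addn0 /spread_history vs andTb => sz.
  case: allP => [_|/allP/allPn[j j_in]]; first by rewrite mulr0 sumr_ge0.
  rewrite -leqNgt mulr1 => a2; rewrite /outside_sum.
  rewrite -natr_sum ler_nat -sz.
  apply: (@leq_trans (count (predC (outside s j)) (tree_vertices s))).
    have := count_predC (outside s j) (tree_vertices s).
    by rewrite size_iota -/(outside_size s j); lia.
  rewrite -sum1_count big_mkcond /=; apply: leq_sum => v _.
  case: ifP => //; rewrite /outside negb_or negbK => /andP[_ /eqP br].
  suff -> : outside_size s v = outside_size s j by rewrite a2.
  by apply: eq_count => w; rewrite /outside br.
rewrite growth_outside_sum; have -> : k.+2 = (k - 2).+4 by lia.
rewrite big_ltn // big_ltn // big_nat big1 ?addr0 // => i /andP[i2 _].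
by rewrite leqNgt i2.
Qed.

Lemma outside_sum_gap_weight_mean {R : realType} k :
  growth k [::] (outside_sum gap_weight) <= 1 :> R.
Proof.
rewrite growth_outside_sum; case: k => [|k].
  by rewrite big_nat1 /gap_weight subrr mul0r invr0.
rewrite big_ltn // big_ltn // /gap_weight !subrr mul0r mulr0 invr0 !add0r.
rewrite /index_iota; apply: le_trans (gap_weight_sum _ _ _) _ => //.
by rewrite (_ : 3 - 2 = 1) ?invr1 //; ring.
Qed.

(** Condition on the tree with [y] vertices. If it is spread, a rank above [x] forces more than
    [x - y] later vertices to overtake, and Markov's inequality applies. *)
Lemma growth_rank_gt {R : realType} n x y : (2 < y < x)%N -> (x <= n)%N ->
  growth n.-1 [::] (fun s => (x < jordan_rank n (history_tree s) 1)%N%:R : R)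
    <= 2 / (y - 2)%:R + 2 / (x - y)%:R.
Proof.
move=> /andP[y2 yx] xn.
have xy0 : 0 < (x - y)%:R :> R by rewrite ltr0n subn_gt0.
have -> : n.-1 = (y.-1 + (n - y))%N by lia.
rewrite growth_add; set rank_gt := fun s => _%:R.
apply: (@le_trans _ _ (growth y.-1 [::] (fun s =>
    (~~ spread_history s)%:R + 2 / (x - y)%:R * outside_sum gap_weight s))).
  apply: (growth_le valid_history) => //; first exact: valid_history_closed.
  move=> s vs; rewrite addn0 => sz.
  have W0 : 0 <= outside_sum gap_weight s :> R := outside_sum_gap_weight_ge0 s.
  case: (boolP (spread_history s)) => [sps|_] /=; last first.
    apply: (@le_trans _ _ 1); last by rewrite lerDl mulr_ge0 // divr_ge0.
    rewrite -[leRHS](@growth_cst _ (n - y) s).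
    apply: (growth_le valid_history) => //; first exact: valid_history_closed.
    by move=> s' _ _; rewrite /rank_gt lern1 leq_b1.
  rewrite add0r mulrAC ler_pdivlMr // mulrC -growthZ.
  apply: le_trans (growth_overtakes_count (n - y) _ sps).
  apply: (growth_le valid_history) => //; first exact: valid_history_closed.
  move=> s' vs' sz'; rewrite /rank_gt.
  have -> : n = (size s').+1 by lia.
  case: ltnP => rk; last by rewrite mulr0 ler0n.
  rewrite mulr1 ler_nat leq_subLR; apply: ltnW; apply: leq_trans rk _.
  have -> : (size s).+1 = y by lia.
  by apply: jordan_rank_root_le => //; lia.
rewrite growthD growthZ; apply: lerD.
  by rewrite subn2; apply: growth_not_spread; lia.
by rewrite ler_piMr ?divr_ge0 // outside_sum_gap_weight_mean.
Qed.

(** * Transfer to the random recursive tree *)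

Definition attachment_history {Omega : Type}
    (U : nat -> Omega -> nat) (n : nat) (w : Omega) : seq nat :=
  rev [seq U k w | k <- iota 1 n.-1].

Lemma size_attachment_history {Omega : Type} (U : nat -> Omega -> nat) n w :
  size (attachment_history U n w) = n.-1.
Proof. by rewrite size_rev size_map size_iota. Qed.

Lemma attachment_historyS {Omega : Type} (U : nat -> Omega -> nat) n w : (0 < n)%N ->
  attachment_history U n.+1 w = U n w :: attachment_history U n w.
Proof.
case: n => // n _; rewrite /attachment_history.
by rewrite -[iota 1 n.+2.-1]/(vertices n.+1) verticesS map_rcons rev_rcons.
Qed.

(** Induction with [B] general: fixing the last attachment [i] leaves the event [B (i :: _)] about
    the past, which is independent of it. Measurability is carried along for additivity over [i]. *)
Lemma probability_attachment_history {d : measure_display} {Omega : measurableType d}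
    {R : realType} (P : probability Omega R) (U : nat -> {mfun Omega >-> nat}) :
  (forall n w, (0 < n)%N -> U n w \in vertices n) ->
  (forall n i, (0 < n)%N -> i \in vertices n ->
    P [set w | U n w = i] = (n%:R^-1)%:E) ->
  (forall n (A : set nat) (B : set (seq nat)), (0 < n)%N ->
    P ([set w | A (U n w)] `&` [set w | B [seq U k w | k <- iota 1 n.-1]]) =
    (P [set w | A (U n w)] * P [set w | B [seq U k w | k <- iota 1 n.-1]])%E) ->
  forall n (B : pred (seq nat)), (0 < n)%N ->
    measurable [set w | B (attachment_history U n w)] /\
    P [set w | B (attachment_history U n w)] =
      (growth n.-1 [::] (fun s => (B s)%:R))%:E.
Proof.
move=> U_in U_unif U_indep; elim=> // n IH B _.
case: (posnP n) IH => [-> _|n0 IH].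
  rewrite /attachment_history /=.
  case: (B [::]) => /=.
    by rewrite (_ : [set _ | _] = setT) ?probability_setT //; apply/seteqP; split.
  by rewrite (_ : [set _ | _] = set0) ?measure0 //; apply/seteqP; split.
pose F i := [set w | U n w = i] `&` [set w | B (i :: attachment_history U n w)].
have -> : [set w | B (attachment_history U n.+1 w)] =
    \bigcup_(i in [set` vertices n]) F i.
  apply/seteqP; split=> [w /=|w [i _ [/= Ui]]]; rewrite attachment_historyS //.
    by move=> Bw; exists (U n w) => //=; exact: U_in.
  by rewrite Ui.
have mF i : measurable (F i).
  apply: measurableI; last by have [] := IH (fun s => B (i :: s)) isT.
  exact: (@measurable_funPTI _ _ _ _ (U n) [set i] Logic.I).
split; first by apply: fin_bigcup_measurable.
rewrite measure_fin_bigcup //; last 2 first.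
- exact: finite_seq.
- by move=> i j _ _ [w [[/= <- _] [/= <- _]]].
rewrite -fsbig_seq ?iota_uniq //.
transitivity (\sum_(i <- vertices n)
    (n%:R^-1 * growth n.-1 [::] (fun s => (B (i :: s))%:R : R))%:E)%E.
  rewrite big_seq [RHS]big_seq; apply: eq_bigr => i i_in.
  have [_ IHi] := IH (fun s => B (i :: s)) isT.
  rewrite EFinM -IHi -(U_unif _ _ n0 i_in).
  exact: (U_indep n [set i] [set p | B (i :: rev p)] n0).
rewrite sumEFin -mulr_sumr -growth_sum -growthZ; congr (_%:E).
(* The last attachment is the innermost average of [growth], so it is split off at the end. *)
have -> : n.+1.-1 = (n.-1 + 1)%N by lia.
rewrite growth_add; apply: growth_eq => // s _.
by rewrite addn0 => sz; rewrite /= sz prednK.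
Qed.

Lemma urrt_history_tree {Omega : Type} (T : nat -> Omega -> rel nat)
    (U : nat -> Omega -> nat) :
  (forall w, T 1%N w = edgeless) ->
  (forall n w, (0 < n)%N -> T n.+1 w = add_edge (T n w) (U n w) n.+1) ->
  forall n w, (0 < n)%N -> T n w = history_tree (attachment_history U n w).
Proof.
move=> T1 TS; elim=> // n IH w _; case: (posnP n) IH => [-> _|n0 IH].
  by rewrite T1.
by rewrite TS // IH // attachment_historyS //= size_attachment_history prednK.
Qed.

Theorem theorem9 (R : realType) :
  exists c : R, 0 < c /\
    forall (d : measure_display) (Omega : measurableType d)
      (P : probability Omega R) (T : nat -> Omega -> rel nat),
      urrt P T ->
      forall n x : nat, (1 <= n)%N -> (1 <= x <= n)%N ->
        (P [set w | (x < jordan_rank n (T n w) 1)%N] <= (c / x%:R)%:E)%E.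
Proof.
(* For [x <= 12] the bound is at least 1. Beyond that, [y = x./2] gives 2/(y-2) <= 8/x and 2/(x-y)
   <= 4/x, and 8 + 4 = 12. *)
exists 12; split=> // d Omega P T [U [U_in U_unif U_indep T1 TS]] n x n0 /andP[x0 xn].
have TE := urrt_history_tree T U T1 TS.
rewrite (_ : [set w | _] = [set w | (x < jordan_rank n
    (history_tree (attachment_history U n w)) 1)%N]); last first.
  by apply/seteqP; split=> w /=; rewrite TE.
have [_ ->] := probability_attachment_history P U U_in U_unif U_indep n
  (fun s => (x < jordan_rank n (history_tree s) 1)%N) n0.
rewrite lee_fin; have x0' : 0 < x%:R :> R by rewrite ltr0n.
case: (leqP x 12) => x12.
  apply: (@le_trans _ _ 1); last by rewrite ler_pdivlMr // mul1r ler_nat.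
  rewrite -[leRHS](@growth_cst _ n.-1 [::]).
  apply: (growth_le valid_history) => //; first exact: valid_history_closed.
  by move=> s _ _; rewrite lern1 leq_b1.
have y_in : (2 < x./2 < x)%N by lia.
apply: le_trans (growth_rank_gt n x x./2 y_in xn) _.
have le_div k m : (0 < k)%N -> (2 * x <= k * m)%N -> 2 / m%:R <= k%:R / x%:R :> R.
  move=> k0 le_km; have m0 : (0 < m)%N by case: m le_km => //; lia.
  rewrite ler_pdivrMr ?ltr0n // mulrAC ler_pdivlMr // -!natrM ler_nat; lia.
have -> : 12 = 8%:R + 4%:R :> R by ring.
by rewrite [leRHS]mulrDl; apply: lerD; apply: le_div => //; lia.
Qed.
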